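(* Let $p$ be a prime, $n\ge 1$ an integer, and $\alpha_1,\dots,\alpha_n$ positive integers with $\max(\alpha_1,\alpha_2,\dots,\alpha_n)\ge 2$. The Laplacian spectrum of the Co-Prime Order graph $\Theta(G)$ of the group $G=\mathbb{Z}_{p^{\alpha_1}}\times\mathbb{Z}_{p^{\alpha_2}}\times\cdots\times\mathbb{Z}_{p^{\alpha_n}}$ consists of $0$ with multiplicity $1$, $p^{\alpha_1+\alpha_2+\cdots+\alpha_n}$ with multiplicity $p^n$, and $p^n$ with multiplicity $p^{\alpha_1+\alpha_2+\cdots+\alpha_n}-p^n-1$.
   Context: For a finite group $G$, the Co-Prime Order graph $\Theta(G)$ is the simple undirected graph with vertex set $G$ in which two distinct vertices $x,y$ are adjacent if and only if $\gcd(o(x),o(y))$ is $1$ or a prime, where $o(x)$ is the order of $x$. The Laplacian matrix of a finite simple graph $\Gamma$ is $L(\Gamma)=D(\Gamma)-A(\Gamma)$, with $D(\Gamma)$ the diagonal matrix of vertex degrees and $A(\Gamma)$ the adjacency matrix; the Laplacian spectrum is the multiset of eigenvalues of $L(\Gamma)$ (roots of its characteristic polynomial with multiplicity). $\mathbb{Z}_m$ is the cyclic group of order $m$. *)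

(* Defs.v *)
From HB Require Import structures.
From mathcomp Require Import all_boot all_order all_algebra all_fingroup.

Set Implicit Arguments.
Unset Strict Implicit.
Unset Printing Implicit Defensive.

Import GRing.Theory.
Local Open Scope ring_scope.

(* A finite simple graph with vertex set T is a symmetric irreflexive e : rel T;
   its vertices index the rows and columns of matrices through enum_val. *)
Definition degree (T : finType) (e : rel T) (x : T) : nat :=
  #|[set y | e x y]|.

Definition adjacency_mx (R : pzRingType) (T : finType) (e : rel T) :
    'M[R]_#|T| :=
  \matrix_(i, j) (e (enum_val i) (enum_val j))%:R.

Definition degree_mx (R : pzRingType) (T : finType) (e : rel T) :
    'M[R]_#|T| :=
  diag_mx (\row_i (degree e (enum_val i))%:R).

Definition laplacian_mx (R : pzRingType) (T : finType) (e : rel T) :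
    'M[R]_#|T| :=
  degree_mx R e - adjacency_mx R e.

(* The characteristic polynomial is monic and splits, so this sequence lists
   its roots with multiplicity; it is meaningful only up to perm_eq. *)
Definition spectrum (C : closedFieldType) (m : nat) (A : 'M[C]_m) : seq C :=
  sval (closed_field_poly_normal (char_poly A)).

Definition laplacian_spectrum (C : closedFieldType) (T : finType)
    (e : rel T) : seq C :=
  spectrum (laplacian_mx C e).

Definition coprime_order_graph (gT : finGroupType) : rel gT :=
  fun x y => (x != y) &&
    ((gcdn #[x]%g #[y]%g == 1%N) || prime (gcdn #[x]%g #[y]%g)).

Lemma coprime_order_graph_sym (gT : finGroupType) :
  symmetric (@coprime_order_graph gT).
Proof. by move=> x y; rewrite /coprime_order_graph eq_sym gcdnC. Qed.

Lemma coprime_order_graph_irrefl (gT : finGroupType) :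
  irreflexive (@coprime_order_graph gT).
Proof. by move=> x; rewrite /coprime_order_graph eqxx. Qed.

Lemma spectrumE (C : closedFieldType) (m : nat) (A : 'M[C]_m) :
  char_poly A = \prod_(z <- spectrum A) ('X - z%:P).
Proof.
rewrite /spectrum; case: closed_field_poly_normal => s /= {1}->.
by rewrite (monicP (char_poly_monic A)) scale1r.
Qed.

(* External direct product of the cyclic groups Z/m_i, under componentwise
   addition. 'Z_k is Z/kZ only for k > 1, so every m i must exceed 1. *)
Definition prod_Zn (n : nat) (m : 'I_n -> nat) : finGroupType :=
  {dffun forall i : 'I_n, 'Z_(m i)}.

(* Main.v *)
Require Import Defs.
From mathcomp Require Import all_boot all_order all_algebra all_fingroup.
From mathcomp Require Import all_solvable ring.

(** The group [G] is a [p]-group, so every order is a power of [p], and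
    [gcd (p ^ a) (p ^ b)] is 1 or a prime exactly when [minn a b <= 1]. Hence two
    distinct elements are adjacent iff one of them lies in the [p]-torsion set
    [S] of the [x] with [x ^+ p = 1] ([coprime_order_graph_pgroup]): the graph is
    the join of a complete graph on [S] with an edgeless graph on the rest.
    The cyclic factors have [p] elements of [p]-torsion each, so [#|S| = p ^ n]
    ([card_torsion_prod_Zn]), and an exponent of at least 2 leaves some [t]
    outside [S].

    The Laplacian of such a join, on [N] vertices with [s] of them in [S], has
    an explicit eigenbasis ([join_eigenvector]): the constant function [1] for
    0, the functions [N delta_y - 1] for [N] ([y] in [S]), and the functions
    [delta_y - delta_t] for [s] ([y] outside [S], [y != t]), where [delta_y] is
    the indicator of [y]. The vertex [t] serves as the index of the constant
    function. Reading the characteristic polynomial off this basis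
    ([char_poly_laplacian_eigenbasis]) gives the multiplicities [1], [s] and
    [N - s - 1]. *)

Set Implicit Arguments.
Unset Strict Implicit.
Unset Printing Implicit Defensive.

Import GRing.Theory Num.Theory.
Local Open Scope ring_scope.

(** * Characteristic polynomials from eigenbases *)

(** [Q] is not inverted: multiplicativity of the determinant over the
    polynomial ring suffices, since [\det Q] is a nonzero constant there. *)
Lemma char_poly_intertwine (F : fieldType) (m : nat) (A B Q : 'M[F]_m) :
  Q \in unitmx -> A *m Q = Q *m B -> char_poly A = char_poly B.
Proof.
move=> Qunit AQ; pose Qp := map_mx polyC Q.
have detQp : \det Qp != 0.
  by rewrite det_map_mx polyC_eq0 -unitfE -unitmxE.
apply: (mulIf detQp); rewrite [RHS]mulrC /char_poly -!det_mulmx; congr (\det _).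
rewrite /char_poly_mx mulmxBl mulmxBr -!map_mxM AQ; congr (_ - _).
by rewrite scalar_mxC.
Qed.

Lemma big_enum_val_all (R : Type) (idx : R) (op : Monoid.com_law idx)
    (T : finType) (g : T -> R) :
  \big[op/idx]_x g x = \big[op/idx]_(i < #|T|) g (enum_val i).
Proof. by rewrite -big_enum_val; apply: eq_bigl => x; rewrite inE. Qed.

Lemma eq_laplacian_mx (R : pzRingType) (T : finType) (e e' : rel T) :
  e =2 e' -> laplacian_mx R e = laplacian_mx R e'.
Proof.
move=> ee'; rewrite /laplacian_mx; congr (_ - _); last first.
  by apply/matrixP => i j; rewrite !mxE ee'.
congr diag_mx; apply/rowP => i; rewrite !mxE /degree; congr _%:R.
by apply: eq_card => y; rewrite !inE ee'.
Qed.

(** The action of the Laplacian on a function [g] on the vertices is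
    [x |-> \sum_(z | e x z) (g x - g z)]; this form avoids all indexing of
    vertices by ordinals. The second hypothesis makes the square matrix of the
    [f y] invertible: no nonzero functional vanishes on all of them. *)
Lemma char_poly_laplacian_eigenbasis (F : fieldType) (T : finType) (e : rel T)
    (f : T -> T -> F) (d : T -> F) :
  (forall y x, \sum_(z | e x z) (f y x - f y z) = d y * f y x) ->
  (forall v : T -> F, (forall y, \sum_x v x * f y x = 0) -> v =1 fun=> 0) ->
  char_poly (laplacian_mx F e) = \prod_x ('X - (d x)%:P).
Proof.
move=> f_eigen f_sep.
pose Q : 'M[F]_#|T| := \matrix_(i, j) f (enum_val j) (enum_val i).
pose D : 'M[F]_#|T| := diag_mx (\row_j d (enum_val j)).
have Qunit : Q \in unitmx.
  rewrite -row_free_unit; apply: inj_row_free => v vQ0.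
  have v0 := f_sep (fun x => v ord0 (enum_rank x)).
  apply/rowP => i; rewrite mxE -(enum_valK i); apply: v0 => y.
  have /rowP/(_ (enum_rank y)) := vQ0; rewrite !mxE => vQy.
  rewrite -[RHS]vQy big_enum_val_all; apply: eq_bigr => j _.
  by rewrite !mxE enum_valK enum_rankK.
rewrite (@char_poly_intertwine _ _ _ D Q Qunit).
  rewrite char_poly_trig ?diag_mx_is_trig // [RHS]big_enum_val_all.
  by apply: eq_bigr => i _; rewrite !mxE eqxx.
apply/matrixP => i j; rewrite mulmxBl mul_diag_mx mul_mx_diag !mxE.
rewrite [RHS]mulrC -f_eigen sumrB; congr (_ - _).
  by rewrite mulr_natl sumr_const /degree cardsE.
rewrite [RHS]big_mkcond [RHS]big_enum_val_all; apply: eq_bigr => k _.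
by rewrite !mxE; case: (e _ _); rewrite ?mul1r ?mul0r.
Qed.

(** * The join of a complete graph and an edgeless graph *)

Definition join_graph (T : finType) (S : {set T}) : rel T :=
  fun x y => (x != y) && ((x \in S) || (y \in S)).

Section Join.

Variables (F : numFieldType) (T : finType) (S : {set T}) (t : T).
Hypothesis tS : t \notin S.

Let delta (y x : T) : F := (x == y)%:R.

Definition join_eigenvector (y x : T) : F :=
  if y \in S then #|T|%:R * delta y x - 1
  else if y == t then 1 else delta y x - delta t x.

Definition join_eigenvalue (y : T) : F :=
  if y \in S then #|T|%:R else if y == t then 0 else #|S|%:R.

Let sum_delta y : \sum_x delta y x = 1.
Proof. by rewrite (bigD1 y) //= /delta eqxx big1 ?addr0 // => x /negPf->. Qed.

Let sumS_delta y : \sum_(x in S) delta y x = (y \in S)%:R.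
Proof.
case: (boolP (y \in S)) => yS; last first.
  by apply: big1 => x xS; rewrite /delta (negPf (memPn yS x xS)).
rewrite (bigD1 y) //= /delta eqxx big1 ?addr0 // => x /andP[_ /negPf-> //].
Qed.

Lemma laplacian_join_graph (g : T -> F) x :
  \sum_(z | join_graph S x z) (g x - g z) =
  if x \in S then #|T|%:R * g x - \sum_z g z
  else #|S|%:R * g x - \sum_(z in S) g z.
Proof.
case: ifP => xS.
  (* The missing term z = x is zero, so the sum may run over all of T. *)
  have <- : \sum_z (g x - g z) = #|T|%:R * g x - \sum_z g z.
    by rewrite sumrB sumr_const mulr_natl.
  rewrite [RHS](bigD1 x) //= subrr add0r; apply: eq_bigl => z.
  by rewrite /join_graph xS andbT eq_sym.
rewrite mulr_natl -sumr_const -sumrB; apply: eq_bigl => z.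
rewrite /join_graph xS /=; case zS: (z \in S); rewrite ?andbF ?andbT //.
by apply/eqP => xz; rewrite xz zS in xS.
Qed.

Lemma join_eigenvectorP y x :
  \sum_(z | join_graph S x z) (join_eigenvector y x - join_eigenvector y z) =
  join_eigenvalue y * join_eigenvector y x.
Proof.
rewrite laplacian_join_graph /join_eigenvector /join_eigenvalue.
case: (boolP (y \in S)) => yS.
  rewrite !sumrB -!mulr_sumr sum_delta sumS_delta yS !sumr_const.
  case: ifP => xS; first by rewrite mulr1 subrr subr0.
  rewrite /delta (_ : x == y = false); first by rewrite /=; ring.
  by apply/eqP => xy; rewrite xy yS in xS.
case: eqP => [_ | _].
  by rewrite !sumr_const mul0r !mulr1 !subrr if_same.
rewrite !sumrB !sum_delta !sumS_delta (negPf yS) (negPf tS) !subrr !subr0.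
case: ifP => // xS; rewrite /delta.
by rewrite (negPf (memPn yS x xS)) (negPf (memPn tS x xS)) subrr !mulr0.
Qed.

(** Orthogonality to [1] makes the sum of [v] zero; then orthogonality to
    [N delta_y - 1] kills [v] on [S], and [v] is constant off [S] by the
    remaining eigenvectors, so that the sum of [v] is [(N - s) v t]. *)
Lemma join_eigenvector_separating (v : T -> F) :
  (forall y, \sum_x v x * join_eigenvector y x = 0) -> v =1 fun=> 0.
Proof.
move=> v_orth.
have sum_v_delta y : \sum_x v x * delta y x = v y.
  rewrite (bigD1 y) //= /delta eqxx mulr1 big1 ?addr0 // => x /negPf->.
  by rewrite mulr0.
have sum_v : \sum_x v x = 0.
  rewrite -[RHS](v_orth t); apply: eq_bigr => x _.
  by rewrite /join_eigenvector (negPf tS) eqxx mulr1.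
have N_neq0 : #|T|%:R != 0 :> F.
  by rewrite pnatr_eq0 -lt0n; apply/card_gt0P; exists t.
have vS y : y \in S -> v y = 0.
  move=> yS; have := v_orth y; rewrite /join_eigenvector yS.
  under eq_bigr do rewrite mulrBr mulr1 mulrCA.
  rewrite sumrB sum_v subr0 -mulr_sumr sum_v_delta.
  by move/eqP; rewrite mulf_eq0 (negPf N_neq0) => /eqP.
have vC y : y \notin S -> v y = v t.
  move=> yS; have [-> // | yt] := eqVneq y t.
  have := v_orth y; rewrite /join_eigenvector (negPf yS) (negPf yt).
  under eq_bigr do rewrite mulrBr.
  by rewrite sumrB !sum_v_delta => /eqP; rewrite subr_eq0 => /eqP.
have vt : v t = 0.
  move: sum_v; rewrite (bigID (mem S)) /= big1 ?add0r; last exact: vS.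
  rewrite (eq_bigr _ vC) sumr_const -mulr_natl => /eqP; rewrite mulf_eq0.
  rewrite pnatr_eq0 -leqn0 leqNgt; case: card_gt0P => [_ /eqP // | []].
  by exists t.
by move=> y; case: (boolP (y \in S)) => [/vS | /vC ->].
Qed.

Lemma char_poly_laplacian_join_graph :
  char_poly (laplacian_mx F (join_graph S)) =
  'X * ('X - #|T|%:R%:P) ^+ #|S| * ('X - #|S|%:R%:P) ^+ (#|T| - #|S| - 1).
Proof.
rewrite (char_poly_laplacian_eigenbasis join_eigenvectorP
           join_eigenvector_separating).
rewrite (bigID (mem S)) /= [X in _ * X](bigD1 t) //= mulrCA mulrA.
rewrite /join_eigenvalue (negPf tS) eqxx subr0; congr (_ * _ * _).
  by rewrite (eq_bigr (fun=> 'X - #|T|%:R%:P)) ?prodr_const // => x ->.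
rewrite (eq_bigr (fun=> 'X - #|S|%:R%:P)); last first.
  by move=> x /andP[/negPf-> /negPf->].
rewrite prodr_const; congr (_ ^+ _).
rewrite -(cardC S) addKn [in RHS](cardD1 t) inE tS add1n subn1 /=.
by apply: eq_card => x; rewrite !inE andbC.
Qed.

End Join.

(** * Adjacency in the Co-Prime Order graph of a finite p-group *)

Lemma eq1_or_prime_pfactor p k :
  prime p -> (p ^ k == 1)%N || prime (p ^ k) = (k <= 1)%N.
Proof.
move=> p_pr; case: k => [|[|k]]; rewrite ?expn0 ?expn1 ?p_pr ?orbT //.
rewrite gtn_eqF ?orFb; last by rewrite -(exp1n k.+2) ltn_exp2r ?prime_gt1.
apply: negbTE; apply/negP => pk_pr.
have : p == (p ^ k.+2)%N by rewrite -dvdn_prime2 // expnS dvdn_mulr.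
by rewrite -{1}(expn1 p) eqn_exp2l ?prime_gt1.
Qed.

(** Among powers of [p] the gcd is the smaller one, so it is at most [p] as
    soon as one of the two orders divides [p]; the elements whose order divides
    [p] form ['Ldiv_p()]. *)
Lemma coprime_order_graph_pgroup (gT : finGroupType) (p : nat) :
  prime p -> p.-group%g [set: gT] ->
  @coprime_order_graph gT =2 join_graph 'Ldiv_p()%g.
Proof.
move=> p_pr pG x y; rewrite /coprime_order_graph /join_graph !inE.
congr (_ && _).
have ord_pow (z : gT) : exists k, #[z]%g = (p ^ k)%N.
  by have [k ->] := p_natP (mem_p_elt pG (in_setT z)); exists k.
rewrite -!order_dvdn; case: (ord_pow x) (ord_pow y) => [a ->] [b ->].
have dvd_p k : (p ^ k %| p)%N = (k <= 1)%N.
  by rewrite -{2}(expn1 p) dvdn_Pexp2l ?prime_gt1.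
rewrite !dvd_p; case: (leqP a b) => ab.
  rewrite (gcdn_idPl (dvdn_exp2l p ab)) eq1_or_prime_pfactor //.
  by apply/idP/orP => [-> | [] // /(leq_trans ab)]; [left | ].
rewrite (gcdn_idPr (dvdn_exp2l p (ltnW ab))) eq1_or_prime_pfactor //.
by apply/idP/orP => [-> | [/(leq_trans (ltnW ab)) | ] //]; right.
Qed.

(** * The p-torsion of a product of cyclic p-groups *)

(** In an abelian [p]-group the [p]-torsion is the subgroup ['Ohm_1], which in a
    nontrivial cyclic [p]-group is the unique subgroup of order [p]. *)
Lemma card_torsion_Zp_pfactor p k :
  prime p -> (0 < k)%N -> #|('Ldiv_p()%g : {set 'Z_(p ^ k)})| = p.
Proof.
move=> p_pr k_gt0; set Z := [set: 'Z_(p ^ k)].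
have pk_gt1 : (1 < p ^ k)%N by rewrite -(exp1n k) ltn_exp2r ?prime_gt1.
have cardZ : #|Z| = (p ^ k)%N by rewrite cardsT card_ord Zp_cast.
have cycZ : cyclic Z by apply/cyclicP; exists Zp1; apply: Zp_cycle.
have pZ : p.-group%g Z by rewrite /pgroup cardZ pnatX pnat_id.
have card_Ohm : #|'Ohm_1(Z)%g| = p.
  apply: Ohm1_cyclic_pgroup_prime => //.
  by apply: contraTneq pk_gt1 => /= Z1; rewrite -cardZ /Z Z1 cards1.
rewrite -[RHS]card_Ohm (OhmEabelian pZ) ?expn1 ?setTI //.
exact: abelianS (Ohm_sub 1 _) (cyclic_abelian cycZ).
Qed.

Section ProdZn.

Variables (p n : nat) (alpha : 'I_n -> nat).
Hypotheses (p_pr : prime p) (alpha_gt0 : forall i, (0 < alpha i)%N).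
Let G := prod_Zn (fun i => p ^ alpha i)%N.

Lemma card_prod_Zn : #|G| = (p ^ \sum_i alpha i)%N.
Proof.
rewrite card_dep_ffun foldrE big_map big_enum /= expn_sum.
apply: eq_bigr => i _; rewrite card_ord Zp_cast //.
by rewrite -(exp1n (alpha i)) ltn_exp2r ?prime_gt1.
Qed.

Lemma card_torsion_prod_Zn : #|('Ldiv_p()%g : {set G})| = (p ^ n)%N.
Proof.
pose tors i : {set 'Z_(p ^ alpha i)} := 'Ldiv_p()%g.
transitivity #|(family (fun i => mem (tors i)) : simpl_pred G)|.
  have expE (x : G) k i : (x ^+ k)%g i = (x i ^+ k)%g.
    by elim: k => [|k IHk]; rewrite ?expg0 ?expgS ffunE ?IHk.
  apply: eq_card => x; rewrite inE; apply/eqP/familyP => [xp1 i | x_tors].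
    by rewrite !inE -expE xp1 ffunE.
  by apply/ffunP => i; rewrite expE ffunE; have := x_tors i; rewrite !inE => /eqP.
rewrite card_family foldrE big_map big_enum /=.
rewrite (eq_bigr (fun=> p)) ?prod_nat_const ?card_ord // => i _.
exact: card_torsion_Zp_pfactor.
Qed.

Lemma pgroup_prod_Zn : p.-group%g [set: G].
Proof. by rewrite /pgroup cardsT card_prod_Zn pnatX pnat_id. Qed.

Lemma card_torsion_prod_Zn_lt :
  (2 <= \max_i alpha i)%N -> (p ^ n < p ^ \sum_i alpha i)%N.
Proof.
move=> alpha_max; rewrite ltn_exp2l ?prime_gt1 //.
have [i alpha_i] : exists i, (2 <= alpha i)%N.
  apply/existsP; apply: contraLR alpha_max => /existsPn alpha_le1.
  by rewrite -ltnNge ltnS; apply/bigmax_leqP => i _; rewrite leqNgt alpha_le1.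
rewrite -{1}(card_ord n) -sum1_card (bigD1 i) //= [ltnRHS](bigD1 i) //=.
by rewrite -addSn leq_add // leq_sum.
Qed.

End ProdZn.

Theorem theorem4 (C : numClosedFieldType) (p : nat) (hp : prime p)
    (n : nat) (hn : (1 <= n)%N) (alpha : 'I_n -> nat)
    (halpha : forall i : 'I_n, (0 < alpha i)%N)
    (hmax : (2 <= \max_(i < n) alpha i)%N) :
  let G := prod_Zn (fun i : 'I_n => (p ^ alpha i)%N) in
  let N := (p ^ (\sum_(i < n) alpha i))%N in
  perm_eq (laplacian_spectrum C (@coprime_order_graph G))
          (nseq 1 (0 : C)
           ++ nseq (p ^ n)%N ((N%:R : C))
           ++ nseq (N - p ^ n - 1)%N (((p ^ n)%N%:R : C))).
Proof.
cbv zeta; set G := prod_Zn _; set N := (p ^ \sum_(i < n) alpha i)%N.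
have cardG : #|G| = N := card_prod_Zn hp halpha.
have cardS := card_torsion_prod_Zn hp halpha; rewrite -/G in cardS.
have [t tS] : exists t : G, t \notin 'Ldiv_p()%g.
  apply/existsP; rewrite -negb_forall; apply/negP => /forallP allS.
  have := card_torsion_prod_Zn_lt hp halpha hmax; rewrite -/N -cardG -cardS ltnNge.
  by rewrite subset_leq_card //; apply/subsetP => x _; apply: allS.
apply: prod_XsubC_eq; rewrite -spectrumE.
rewrite (eq_laplacian_mx _ (coprime_order_graph_pgroup hp
                              (pgroup_prod_Zn hp halpha))).
rewrite (char_poly_laplacian_join_graph C tS) cardG cardS.
by rewrite !big_cat !big_nseq !iter_mulr_1 expr1 polyC0 subr0 /= mulrA.
Qed.
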